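(* Let $\mathbb{F}$ be a field of characteristic zero. Let $\mathcal{A}$ be a finitely generated $\mathbb{Z}$-module of rank $r\geq 2$, let $p\in\mathcal{A}$ be nonzero and let $t\in\mathbb{C}$. Then the automorphism group of the algebra $R_{p,t,\mathcal{A}}$ is isomorphic to a semidirect product $$\operatorname{Aut}(R_{p,t,\mathcal{A}})\cong(\mathbb{F}^{\times})^{2r+1}\rtimes\operatorname{GL}(2r+1,\mathbb{Z}),$$ where the torus $(\mathbb{F}^{\times})^{2r+1}$ acts by rescaling the generators, and $\operatorname{GL}(2r+1,\mathbb{Z})$ acts by linear substitutions on the exponent lattice of $G\cong\mathbb{Z}\times(\mathcal{A}\times\mathcal{A})$.
   Context: $R_{p,t,\mathcal{A}}=\mathbb{F}[e^{\pm x^{p}e^{t}}, e^{\mathcal{A}x}, x^{\mathcal{A}}]$ is the commutative $\mathbb{F}$-algebra whose generators are formal symbols $e^{\pm x^{p}e^{t}}$, $e^{ax}$ and $x^{a}$ ($a\in\mathcal{A}$) satisfying the multiplicative relations $e^{ax}e^{bx}=e^{(a+b)x}$, $x^{a}x^{b}=x^{a+b}$, $e^{ax}x^{b}=x^{b}e^{ax}$, with $e^{\pm x^{p}e^{t}}$ central and $e^{x^{p}e^{t}}\cdot e^{-x^{p}e^{t}}=1$. The group $G\cong\mathbb{Z}\times(\mathcal{A}\times\mathcal{A})$ is the abelian group of monomials whose group algebra is $R_{p,t,\mathcal{A}}$: the factor $\mathbb{Z}$ corresponds to the powers of $e^{x^{p}e^{t}}$, and $\mathcal{A}\times\mathcal{A}$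 corresponds to the groups $\{e^{ax}\}_{a\in\mathcal{A}}$ and $\{x^{a}\}_{a\in\mathcal{A}}$. $\operatorname{Aut}$ denotes the group of $\mathbb{F}$-algebra automorphisms.
   Formalization: The module A is additionally assumed torsion-free; with torsion (e.g. A = Z² × Z/2) the algebra splits as a product of several Laurent polynomial algebras and its automorphism group is too large for the stated isomorphism. *)

(* Defs.v *)
From HB Require Import structures.
From mathcomp Require Import all_boot all_order all_algebra.
From mathcomp Require Import finmap.
From mathcomp Require Export boolp reals.
From mathcomp Require Export complex.
From mathcomp Require Export monalg.

Set Implicit Arguments.
Unset Strict Implicit.
Unset Printing Implicit Defensive.

Import GRing.Theory Num.Theory.

Local Open Scope fset_scope.
Local Open Scope ring_scope.

(* The group algebra F[G] of an abelian group G, which is written additively.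
   The underlying F-module of finitely supported functions G -> F is the one of
   the multinomials library. Its product on {malg F[K]} is not available here,
   as it requires K to be a monoid whose only invertible element is 1. *)
Definition grpalg (F : fieldType) (G : zmodType) : Type := {malg F[G]}.

Section GroupAlgebra.
Variables (F : fieldType) (G : zmodType).
Local Notation B := (grpalg F G).

HB.instance Definition _ := GRing.Lmodule.copy B {malg F[G]}.

Definition mon (k : G) : B := mkmalgU k 1.

Definition gamul (x y : B) : B :=
  \sum_(k <- msupp x) \sum_(l <- msupp y) mkmalgU (k + l)%R (x@_k * y@_l).

Lemma gamulw (d e : {fset G}) (x y : B) :
  msupp x `<=` d -> msupp y `<=` e ->
  gamul x y = \sum_(k <- d) \sum_(l <- e) mkmalgU (k + l)%R (x@_k * y@_l).
Proof.
move=> le_d le_e; rewrite /gamul (big_fset_incl _ le_d) /=.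
  apply: eq_bigr => k _; apply: big_fset_incl => // l _ /mcoeff_outdom ->.
  by rewrite mulr0 monalgU0.
move=> k _ /mcoeff_outdom xk.
by rewrite big1 // => l _; rewrite xk mul0r monalgU0.
Qed.

Lemma gamulC : commutative gamul.
Proof.
move=> x y; rewrite /gamul exchange_big /=.
by apply: eq_bigr => k _; apply: eq_bigr => l _; rewrite mulrC addrC.
Qed.

Lemma gamulDl : left_distributive gamul +%R.
Proof.
move=> x y z.
rewrite (gamulw (fsubsetUl (msupp x) (msupp y)) (fsubset_refl (msupp z))).
rewrite (gamulw (fsubsetUr (msupp x) (msupp y)) (fsubset_refl (msupp z))).
rewrite (gamulw (msuppD_le x y) (fsubset_refl (msupp z))).
rewrite -big_split /=; apply: eq_bigr => k _.
rewrite -big_split /=; apply: eq_bigr => l _.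
by rewrite mcoeffD mulrDl monalgUD.
Qed.

Lemma gamulDr : right_distributive gamul +%R.
Proof. by move=> x y z; rewrite ![gamul x _]gamulC gamulDl. Qed.

Lemma gamul0 (x : B) : gamul 0 x = 0.
Proof. by rewrite /gamul msupp0 big_seq_fset0. Qed.

Lemma gamulU (k l : G) (a b : F) :
  gamul (mkmalgU k a) (mkmalgU l b) = mkmalgU (k + l)%R (a * b).
Proof. by rewrite (gamulw msuppU_le msuppU_le) !big_seq_fset1 !mcoeffUU. Qed.

Lemma gamul_suml (I : Type) (s : seq I) (f : I -> B) (x : B) :
  gamul (\sum_(i <- s) f i) x = \sum_(i <- s) gamul (f i) x.
Proof. exact: (big_morph (gamul^~ x) (fun _ _ => gamulDl _ _ _) (gamul0 x)). Qed.

Lemma gamul_sumr (I : Type) (s : seq I) (f : I -> B) (x : B) :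
  gamul x (\sum_(i <- s) f i) = \sum_(i <- s) gamul x (f i).
Proof. by rewrite gamulC gamul_suml; apply: eq_bigr => i _; rewrite gamulC. Qed.

Lemma gamulA : associative gamul.
Proof.
move: gamul gamul_suml gamul_sumr gamulU => m suml sumr mU x y z.
rewrite (monalgE x) !suml; apply: eq_bigr => k _.
rewrite (monalgE y) !(suml, sumr); apply: eq_bigr => l _.
rewrite (monalgE z) !sumr; apply: eq_bigr => n _.
by rewrite !mU mulrA addrA.
Qed.

Lemma gamul1 : left_id (mon 0) gamul.
Proof.
move=> x; rewrite [in LHS](monalgE x) gamul_sumr [RHS]monalgE.
by apply: eq_bigr => k _; rewrite gamulU mul1r add0r.
Qed.

Lemma mon_neq0 (k : G) : mon k != 0.
Proof. by rewrite /mon monalgU_eq0 oner_eq0. Qed.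

HB.instance Definition _ := GRing.Zmodule_isComNzRing.Build B
  gamulA gamulC gamul1 gamulDl (mon_neq0 0).

Lemma mkmalgU_mon (k : G) (a : F) : mkmalgU k a = a *: mon k.
Proof. by apply/malgP => l; rewrite mcoeffZ !mcoeffU mulrnAr mulr1. Qed.

Lemma gascaleAl (a : F) (x y : B) : a *: (x * y) = (a *: x) * y.
Proof.
have E b (z : B) : b *: z = gamul (mkmalgU (0 : G) b) z.
  rewrite [z in RHS]monalgE gamul_sumr [z in LHS]monalgE scaler_sumr.
  apply: eq_bigr => k _; rewrite gamulU add0r.
  by apply/malgP => l; rewrite mcoeffZ !mcoeffU mulrnAr.
by rewrite !E; apply: gamulA.
Qed.

HB.instance Definition _ := GRing.Lmodule_isLalgebra.Build F B gascaleAl.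
HB.instance Definition _ := GRing.Lalgebra_isComAlgebra.Build F B.

Lemma monM (k l : G) : mon (k + l) = mon k * mon l.
Proof. by rewrite [RHS]gamulU mulr1. Qed.

Lemma mon0 : mon 0 = 1. Proof. by []. Qed.

Lemma grpalgE (x : B) : x = \sum_(k <- msupp x) x@_k *: mon k.
Proof.
by rewrite [LHS]monalgE; apply: eq_bigr => k _; rewrite mkmalgU_mon.
Qed.

Section Lift.
Variables (S : comAlgType F) (phi : G -> S).
Hypotheses (phi0 : phi 0 = 1) (phiD : forall k l, phi (k + l) = phi k * phi l).

Let lift (x : B) : S := \sum_(k <- msupp x) x@_k *: phi k.

Let liftw (d : {fset G}) (x : B) :
  msupp x `<=` d -> lift x = \sum_(k <- d) x@_k *: phi k.
Proof.
move=> le_d; apply: big_fset_incl => // k _ /mcoeff_outdom ->.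
by rewrite scale0r.
Qed.

Let lift_linear : linear lift.
Proof.
move=> a x y; set d := msupp x `|` msupp y.
have le_x : msupp x `<=` d by apply: fsubsetUl.
have le_y : msupp y `<=` d by apply: fsubsetUr.
have le_xy : msupp (a *: x + y : B) `<=` d.
  apply: fsubset_trans (msuppD_le _ _) _.
  by rewrite fsubUset le_y (fsubset_trans (msuppZ_le _ _) le_x).
rewrite (liftw le_x) (liftw le_y) (liftw le_xy) scaler_sumr -big_split /=.
by apply: eq_bigr => k _; rewrite mcoeffD mcoeffZ scalerDl scalerA.
Qed.

HB.instance Definition _ := GRing.isLinear.Build F B S *:%R lift lift_linear.

Let lift_mon (k : G) : lift (mon k) = phi k.
Proof.
by rewrite (liftw msuppU_le) big_seq_fset1 mcoeffUU scale1r.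
Qed.

Let liftZ (a : F) (x : B) : lift (a *: x) = a *: lift x.
Proof. exact: linearZ. Qed.

Let lift_monoid : monoid_morphism lift.
Proof.
split=> [|x y]; first by rewrite -mon0 lift_mon.
rewrite {1}(grpalgE x) {1}(grpalgE y) mulr_suml raddf_sum mulr_suml.
apply: eq_bigr => k _; rewrite mulr_sumr raddf_sum mulr_sumr.
apply: eq_bigr => l _.
rewrite -scalerAl -scalerAr -monM /= !liftZ lift_mon phiD.
by rewrite -scalerAl -scalerAr [in RHS]scalerA [in LHS]scalerA mulrC.
Qed.

HB.instance Definition _ := GRing.isMonoidMorphism.Build B S lift lift_monoid.

Lemma grpalg_lift : exists f : {lrmorphism B -> S}, forall k, f (mon k) = phi k.
Proof. by exists lift. Qed.

End Lift.

Lemma grpalg_ext (S : lmodType F) (f g : {linear B -> S}) :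
  (forall k, f (mon k) = g (mon k)) -> f =1 g.
Proof.
move=> fg x; rewrite (grpalgE x) !raddf_sum; apply: eq_bigr => k _.
by rewrite /= !linearZ_LR fg.
Qed.

End GroupAlgebra.

Definition intexpg (U : groupType) (x : U) (z : int) : U :=
  match z with Posz n => x ^+ n | Negz n => x ^- n.+1 end%g.

Section UnitGroup.
Variable K : unitRingType.

Record unit_group := UnitGroup { uval : K; uvalP : uval \is a GRing.unit }.

HB.instance Definition _ := [isSub for uval].
HB.instance Definition _ := [Choice of unit_group by <:].

Lemma ug_mul_subproof (x y : unit_group) : uval x * uval y \is a GRing.unit.
Proof. by rewrite rpredM // uvalP. Qed.

Lemma ug_inv_subproof (x : unit_group) : (uval x)^-1 \is a GRing.unit.
Proof. by rewrite rpredV uvalP. Qed.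

Definition ug_one := UnitGroup (unitr1 K).
Definition ug_mul x y := UnitGroup (ug_mul_subproof x y).
Definition ug_inv x := UnitGroup (ug_inv_subproof x).

Lemma ug_mulA : associative ug_mul.
Proof. by move=> x y z; apply: val_inj; rewrite /= mulrA. Qed.
Lemma ug_mul1 : left_id ug_one ug_mul.
Proof. by move=> x; apply: val_inj; rewrite /= mul1r. Qed.
Lemma ug_mulr1 : right_id ug_one ug_mul.
Proof. by move=> x; apply: val_inj; rewrite /= mulr1. Qed.
Lemma ug_mulV : left_inverse ug_one ug_inv ug_mul.
Proof. by move=> x; apply: val_inj; rewrite /= mulVr ?uvalP. Qed.
Lemma ug_mulrV : right_inverse ug_one ug_inv ug_mul.
Proof. by move=> x; apply: val_inj; rewrite /= mulrV ?uvalP. Qed.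

HB.instance Definition _ :=
  isGroup.Build unit_group ug_mulA ug_mul1 ug_mulr1 ug_mulV ug_mulrV.

Lemma uvalM (x y : unit_group) : uval (x * y)%g = uval x * uval y.
Proof. by []. Qed.
Lemma uval1 : uval 1%g = 1. Proof. by []. Qed.
Lemma uvalV (x : unit_group) : uval (x^-1)%g = (uval x)^-1.
Proof. by []. Qed.

Lemma uvalX (x : unit_group) (n : nat) : uval (x ^+ n)%g = uval x ^+ n.
Proof. by elim: n => [|n IH] //; rewrite expgS uvalM IH exprS. Qed.

Lemma uvalXz (x : unit_group) (z : int) : uval (intexpg x z) = uval x ^ z.
Proof. by case: z => n /=; rewrite ?uvalV uvalX. Qed.

End UnitGroup.

Lemma uval_prod (K : fieldType) (n : nat) (c : 'I_n -> unit_group K) :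
  uval (\prod_i c i)%g = \prod_i uval (c i).
Proof. by apply: (big_morph (@uval K)). Qed.

Section GLZ.
Variable n : nat.

Record GLZ := MkGLZ { glmx : 'M[int]_n; glmxP : glmx \in unitmx }.

HB.instance Definition _ := [isSub for glmx].
HB.instance Definition _ := [Choice of GLZ by <:].

Lemma gl_mul_subproof (M N : GLZ) : glmx M *m glmx N \in unitmx.
Proof. by rewrite unitmx_mul !glmxP. Qed.

Lemma gl_inv_subproof (M : GLZ) : invmx (glmx M) \in unitmx.
Proof. by rewrite unitmx_inv glmxP. Qed.

Definition gl_one := MkGLZ (unitmx1 int n).
Definition gl_mul M N := MkGLZ (gl_mul_subproof M N).
Definition gl_inv M := MkGLZ (gl_inv_subproof M).

Lemma gl_mulA : associative gl_mul.
Proof. by move=> x y z; apply: val_inj; rewrite /= mulmxA. Qed.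
Lemma gl_mul1 : left_id gl_one gl_mul.
Proof. by move=> x; apply: val_inj; rewrite /= mul1mx. Qed.
Lemma gl_mulr1 : right_id gl_one gl_mul.
Proof. by move=> x; apply: val_inj; rewrite /= mulmx1. Qed.
Lemma gl_mulV : left_inverse gl_one gl_inv gl_mul.
Proof. by move=> x; apply: val_inj; rewrite /= mulVmx ?glmxP. Qed.
Lemma gl_mulrV : right_inverse gl_one gl_inv gl_mul.
Proof. by move=> x; apply: val_inj; rewrite /= mulmxV ?glmxP. Qed.

HB.instance Definition _ :=
  isGroup.Build GLZ gl_mulA gl_mul1 gl_mulr1 gl_mulV gl_mulrV.

End GLZ.

Record gaction (H N : groupType) := GAction {
  gact :> H -> N -> N;
  gact1 : forall x, gact 1%g x = x;
  gactM : forall g h x, gact (g * h)%g x = gact g (gact h x);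
  gact_morph : forall g, {morph gact g : x y / (x * y)%g}
}.

(* N ><| H, for the action a of H on N by automorphisms. *)
Record semidirect (H N : groupType) (a : gaction H N) :=
  SemiPair { sd_norm : N; sd_compl : H }.

Section Semidirect.
Variables (H N : groupType) (a : gaction H N).
Local Notation semidirect := (semidirect a).
Local Notation SemiPair := (SemiPair a).

Definition sd_pair (x : semidirect) := (sd_norm x, sd_compl x).
Definition pair_sd (u : N * H) := SemiPair u.1 u.2.
Lemma sd_pairK : cancel sd_pair pair_sd. Proof. by case. Qed.
HB.instance Definition _ := Choice.copy semidirect (can_type sd_pairK).

Definition sd_one := SemiPair 1%g 1%g.
Definition sd_mul (x y : semidirect) :=
  SemiPair (sd_norm x * a (sd_compl x) (sd_norm y))%g
           (sd_compl x * sd_compl y)%g.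
Definition sd_inv (x : semidirect) :=
  SemiPair (a (sd_compl x)^-1%g (sd_norm x)^-1%g) (sd_compl x)^-1%g.

Lemma gact_1r h : a h 1%g = 1%g.
Proof. by apply: (mulgI (a h 1%g)); rewrite -gact_morph !mulg1. Qed.

Lemma sd_mulA : associative sd_mul.
Proof.
case=> [x g] [y h] [z k]; rewrite /sd_mul /=.
by rewrite gact_morph gactM !mulgA.
Qed.
Lemma sd_mul1 : left_id sd_one sd_mul.
Proof. by case=> x g; rewrite /sd_mul /= gact1 !mul1g. Qed.
Lemma sd_mulr1 : right_id sd_one sd_mul.
Proof. by case=> x g; rewrite /sd_mul /= gact_1r !mulg1. Qed.
Lemma sd_mulV : left_inverse sd_one sd_inv sd_mul.
Proof.
by case=> x g; rewrite /sd_mul /= -gact_morph !mulVg gact_1r.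
Qed.
Lemma sd_mulrV : right_inverse sd_one sd_inv sd_mul.
Proof.
by case=> x g; rewrite /sd_mul /= -gactM !mulgV gact1 mulgV.
Qed.

HB.instance Definition _ :=
  isGroup.Build semidirect sd_mulA sd_mul1 sd_mulr1 sd_mulV sd_mulrV.

End Semidirect.

Section AlgAut.
Variables (F : fieldType) (B : algType F).

Record algAut := AlgAut {
  aut_fun :> B -> B;
  aut_inv : B -> B;
  aut_linear : linear aut_fun;
  aut_monoid : monoid_morphism aut_fun;
  aut_funK : cancel aut_fun aut_inv;
  aut_invK : cancel aut_inv aut_fun
}.

Lemma algAut_eq (f g : algAut) : f =1 g -> f = g.
Proof.
case: f g => [f f' lf mf fK f'K] [g g' lg mg gK g'K] /= /funext fg.
subst g; have fg' : f' = g' by apply/funext => x; rewrite -{1}[x]g'K fK.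
by subst g'; congr AlgAut; apply: Prop_irrelevance.
Qed.

HB.instance Definition _ := gen_eqMixin algAut.
HB.instance Definition _ := gen_choiceMixin algAut.

Definition aut_one : algAut.
Proof. by exists id id. Defined.

Definition aut_mul (f g : algAut) : algAut.
Proof.
exists (f \o g) (aut_inv g \o aut_inv f).
- by move=> a x y; rewrite /= aut_linear aut_linear.
- case: (aut_monoid f) (aut_monoid g) => [f1 fM] [g1 gM].
  by split=> [|x y] /=; rewrite ?g1 ?f1 // gM fM.
- by move=> x; rewrite /= !aut_funK.
- by move=> x; rewrite /= !aut_invK.
Defined.

Definition aut_opp (f : algAut) : algAut.
Proof.
exists (aut_inv f) f.
- by move=> a x y; apply: (can_inj (aut_funK f)); rewrite aut_linear !aut_invK.
- case: (aut_monoid f) => [f1 fM].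
  by split=> [|x y]; apply: (can_inj (aut_funK f)); rewrite ?fM !aut_invK ?f1.
- exact: aut_invK.
- exact: aut_funK.
Defined.

Lemma aut_mulA : associative aut_mul.
Proof. by move=> f g h; apply: algAut_eq. Qed.
Lemma aut_mul1 : left_id aut_one aut_mul.
Proof. by move=> f; apply: algAut_eq. Qed.
Lemma aut_mulr1 : right_id aut_one aut_mul.
Proof. by move=> f; apply: algAut_eq. Qed.
Lemma aut_mulV : left_inverse aut_one aut_opp aut_mul.
Proof. by move=> f; apply: algAut_eq => x /=; rewrite aut_funK. Qed.
Lemma aut_mulrV : right_inverse aut_one aut_opp aut_mul.
Proof. by move=> f; apply: algAut_eq => x /=; rewrite aut_invK. Qed.

HB.instance Definition _ :=
  isGroup.Build algAut aut_mulA aut_mul1 aut_mulr1 aut_mulV aut_mulrV.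

Lemma aut_funM (f g : algAut) (x : B) : (f * g)%g x = f (g x).
Proof. by []. Qed.

End AlgAut.

Definition torus (F : fieldType) (n : nat) := {ffun 'I_n -> unit_group F}.

HB.instance Definition _ F n := Group.on (torus F n).

Section TorusAction.
Variables (F : fieldType) (n : nat).

(* The torus is Hom(Z^n, F^x), with c sending v to \prod_j c_j ^ v_j, and M
   acts on it by c |-> c \o M^-1, where M^-1 acts on column vectors. This is
   how substitutions by M conjugate rescalings by c. *)
Definition torus_act (M : GLZ n) (c : torus F n) : torus F n :=
  [ffun i => \prod_j intexpg (c j) (glmx M^-1 j i)]%g.

Lemma torus_actE M c i :
  uval (torus_act M c i) = \prod_j uval (c j) ^ glmx M^-1%g j i.
Proof.
by rewrite ffunE uval_prod; apply: eq_bigr => j _; rewrite uvalXz.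
Qed.

Let unz (c : unit_group F) : uval c != 0. Proof. by rewrite -unitfE uvalP. Qed.

Let torusP (c d : torus F n) : (forall i, uval (c i) = uval (d i)) -> c = d.
Proof. by move=> cd; apply/ffunP => i; apply: val_inj; apply: cd. Qed.

Let expfz_sum (x : F) (I : finType) (f : I -> int) :
  x != 0 -> x ^ (\sum_i f i) = \prod_i x ^ f i.
Proof. by move=> x0; apply: (big_morph (exprz x)) => // a b; apply: expfzDr. Qed.

Let exprz_prod (z : int) (I : finType) (f : I -> F) :
  (\prod_i f i) ^ z = \prod_i f i ^ z.
Proof.
apply: (big_morph (fun x => x ^ z)) => [x y|]; [exact: expfzMl | exact: exp1rz].
Qed.

Lemma torus_act1 c : torus_act 1%g c = c.
Proof.
apply: torusP => i; rewrite torus_actE invg1 (bigD1 i) //= big1 ?mulr1.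
  by rewrite mxE eqxx.
by move=> j /negbTE ji; rewrite mxE ji.
Qed.

Lemma torus_actM M N c : torus_act (M * N)%g c = torus_act M (torus_act N c).
Proof.
apply: torusP => i; rewrite !torus_actE invgM /=.
under [RHS]eq_bigr => j _ do rewrite torus_actE exprz_prod.
rewrite exchange_big /=; apply: eq_bigr => k _.
rewrite mxE expfz_sum ?unz //; apply: eq_bigr => j _.
by rewrite exprzAC exprz_exp mulrC.
Qed.

Lemma torus_act_morph M : {morph torus_act M : c d / (c * d)%g}.
Proof.
move=> c d; apply: torusP => i; rewrite [in RHS]ffunE uvalM !torus_actE.
rewrite -big_split /=; apply: eq_bigr => j _.
by rewrite ffunE uvalM expfzMl.
Qed.

Definition torus_gaction : gaction (GLZ n) (torus F n) :=
  GAction torus_act1 torus_actM torus_act_morph.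

End TorusAction.

Section ZModules.
Variable A : zmodType.

Definition zfin_gen := exists (n : nat) (s : 'I_n -> A),
  forall a, exists c : 'I_n -> int, a = \sum_i s i *~ c i.

Definition ztorsion_free := forall (a : A) (z : int), a *~ z = 0 -> a = 0 \/ z = 0.

Definition zfree (n : nat) (b : 'I_n -> A) :=
  forall c : 'I_n -> int, \sum_i b i *~ c i = 0 -> forall i, c i = 0.

Definition has_zrank (r : nat) :=
  (exists b : 'I_r -> A, zfree b) /\
  (forall n (b : 'I_n -> A), zfree b -> (n <= r)%N).

Definition zbasis (n : nat) (b : 'I_n -> A) :=
  zfree b /\ forall a, exists c : 'I_n -> int, a = \sum_i b i *~ c i.

End ZModules.

(* The formal monomial e^{z x^p e^t} e^{a x} x^b is encoded as (z, (a, b)), and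
   the group law is written additively. The symbol e^{x^p e^t} satisfies no
   relation involving p or t, so these only label the type. *)
Definition monomials (R : realType) (A : zmodType) (p : A) (t : R[i]) : Type :=
  (int * (A * A))%type.

HB.instance Definition _ R A p t := GRing.Zmodule.on (@monomials R A p t).

Definition Ralg (F : fieldType) (R : realType) (A : zmodType) (p : A) (t : R[i]) :=
  grpalg F (monomials p t).

HB.instance Definition _ F R A p t := GRing.ComAlgebra.on (@Ralg F R A p t).

Section Generators.
Variables (F : fieldType) (R : realType) (A : zmodType) (p : A) (t : R[i]).
Local Notation B := (Ralg F p t).

Definition Rmon (k : monomials p t) : B := mon F k.

(* The generators e^{x^p e^t}, e^{- x^p e^t}, e^{a x} and x^a. *)
Definition exp_pt : B := Rmon (1, (0, 0)).
Definition exp_ptV : B := Rmon (-1, (0, 0)).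
Definition exp_lin (a : A) : B := Rmon (0, (a, 0)).
Definition pow_x (a : A) : B := Rmon (0, (0, a)).

Let pairE (k l : monomials p t) :
  k + l = (k.1 + l.1, (k.2.1 + l.2.1, k.2.2 + l.2.2)).
Proof. by []. Qed.

Lemma RmonD k l : Rmon (k + l) = Rmon k * Rmon l.
Proof. exact: monM. Qed.

Lemma exp_ptK : exp_pt * exp_ptV = 1.
Proof. by rewrite -RmonD pairE /= !addr0. Qed.

Lemma exp_linD a b : exp_lin (a + b) = exp_lin a * exp_lin b.
Proof. by rewrite -RmonD pairE /= !addr0. Qed.

Lemma exp_lin0 : exp_lin 0 = 1.
Proof. by []. Qed.

Lemma pow_xD a b : pow_x (a + b) = pow_x a * pow_x b.
Proof. by rewrite -RmonD pairE /= !addr0. Qed.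

Lemma pow_x0 : pow_x 0 = 1.
Proof. by []. Qed.

(* Ralg is presented by these generators and relations, in the class of
   commutative F-algebras. *)
Lemma Ralg_presentation (S : comAlgType F) (u v : S) (f g : A -> S) :
    u * v = 1 -> f 0 = 1 -> g 0 = 1 ->
    (forall a b, f (a + b) = f a * f b) ->
    (forall a b, g (a + b) = g a * g b) ->
  exists h : {lrmorphism B -> S},
    [/\ h exp_pt = u, h exp_ptV = v,
        forall a, h (exp_lin a) = f a & forall a, h (pow_x a) = g a] /\
    forall h' : {lrmorphism B -> S},
      [/\ h' exp_pt = u, h' exp_ptV = v,
          forall a, h' (exp_lin a) = f a & forall a, h' (pow_x a) = g a] ->
      h' =1 h.
Proof.
move=> uv f0 g0 fD gD.
pose w (z : int) : S := match z with Posz n => u ^+ n | Negz n => v ^+ n.+1 end.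
have wB (m n : nat) : w (m%:Z - n%:Z) = u ^+ m * v ^+ n.
  have [le_nm|/ltnW le_mn] := leqP n m.
    rewrite subzn //= -{2}(subnK le_nm) exprD -mulrA -exprMn uv expr1n.
    by rewrite mulr1.
  rewrite -opprB subzn // -{2}(subnK le_mn) addnC exprD mulrA -exprMn uv expr1n.
  by rewrite mul1r; case: (n - m)%N => [|k] //=; rewrite -NegzE.
have wE z : exists m n : nat, z = m%:Z - n%:Z.
  case: z => n; first by exists n, 0%N; rewrite subr0.
  by exists 0%N, n.+1; rewrite sub0r NegzE.
have wD y z : w (y + z) = w y * w z.
  have [m [n ->]] := wE y; have [m' [n' ->]] := wE z.
  by rewrite addrACA -opprD -!PoszD !wB !exprD mulrACA.
pose phi (k : monomials p t) : S := w k.1 * (f k.2.1 * g k.2.2).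
have phi0 : phi 0 = 1 by rewrite /phi /= f0 g0 !mulr1.
have phiD k l : phi (k + l) = phi k * phi l.
  by rewrite /phi pairE /= wD fD gD [in LHS](mulrACA (f _)) [LHS]mulrACA.
have [h hE] := grpalg_lift phi0 phiD; exists h; split.
  by split=> [||a|a]; rewrite [LHS]hE /phi /= ?f0 ?g0 ?mulr1 ?mul1r.
move=> h' [h'u h'v h'f h'g].
have h'M (x y : B) : h' (x * y) = h' x * h' y by exact: rmorphM.
have Rmon_eq k : Rmon k = Rmon (k.1, (0, 0)) * (exp_lin k.2.1 * pow_x k.2.2).
  by case: k => z [a b]; rewrite -!RmonD !pairE /= !addr0 !add0r.
have RmonX n : h' (Rmon (n%:Z, (0, 0))) = u ^+ n.
  elim: n => [|n IH]; first exact: rmorph1.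
  rewrite exprSr -IH -h'u -h'M -RmonD pairE /= !addr0.
  by rewrite -addn1 PoszD.
have RmonV n : h' (Rmon (- n%:Z, (0, 0))) = v ^+ n.
  elim: n => [|n IH]; first exact: rmorph1.
  rewrite exprSr -IH -h'v -h'M -RmonD pairE /= !addr0.
  by rewrite -addn1 PoszD opprD.
apply: grpalg_ext => k; apply: etrans (esym (hE k)).
change (h' (Rmon k) = phi k); rewrite Rmon_eq !h'M h'f h'g.
by congr (_ * _); case: (k.1) => n; rewrite ?NegzE ?RmonX ?RmonV.
Qed.

Variables (r : nat) (b : 'I_r -> A).

(* e^{x^p e^t}, then the e^{b_k x}, then the x^{b_k}. *)
Definition Rgen (i : 'I_(1 + (r + r))) : B :=
  match split i with
  | inl _ => exp_pt
  | inr j => match split j with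
             | inl k => exp_lin (b k)
             | inr k => pow_x (b k)
             end
  end.

(* The element of the group of monomials with exponent vector v, relative to
   the Z-basis b of A and in the same order. *)
Definition lattice_mon (v : 'cV[int]_(1 + (r + r))) : monomials p t :=
  (v (lshift (r + r) ord0) ord0,
   (\sum_k b k *~ v (rshift 1 (lshift r k)) ord0,
    \sum_k b k *~ v (rshift 1 (rshift r k)) ord0)).

Lemma Rmon_lattice_delta i : Rmon (lattice_mon (delta_mx i ord0)) = Rgen i.
Proof.
rewrite /Rgen /lattice_mon !mxE.
have sum0 (c : 'I_r -> bool) : (forall k, c k = false) ->
    \sum_k b k *~ (nat_of_bool (c k))%:R = 0.
  by move=> c0; rewrite big1 // => k _; rewrite c0 mulr0z.
have sum1 j : \sum_k b k *~ (nat_of_bool (k == j))%:R = b j.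
  rewrite (bigD1 j) //= eqxx mulr1z big1 ?addr0 // => k /negbTE ->.
  by rewrite mulr0z.
have [j ->|i' ->] := split_ordP i.
  rewrite /exp_pt [j]ord1; congr (Rmon (_, (_, _))).
  - rewrite -[RHS](sum0 (fun=> false)) //; apply: eq_bigr => k _.
    by rewrite mxE eq_shift.
  - rewrite -[RHS](sum0 (fun=> false)) //; apply: eq_bigr => k _.
    by rewrite mxE eq_shift.
rewrite eq_shift.
have [j ->|j ->] := split_ordP i'.
  rewrite /exp_lin; congr (Rmon (_, (_, _))).
  - rewrite -[RHS]sum1; apply: eq_bigr => k _.
    by rewrite mxE !eq_shift andbT.
  - rewrite -[RHS](sum0 (fun=> false)) //; apply: eq_bigr => k _.
    by rewrite mxE !eq_shift.
rewrite /pow_x; congr (Rmon (_, (_, _))).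
- rewrite -[RHS](sum0 (fun=> false)) //; apply: eq_bigr => k _.
  by rewrite mxE !eq_shift.
- rewrite -[RHS]sum1; apply: eq_bigr => k _.
  by rewrite mxE !eq_shift andbT.
Qed.

End Generators.

(* Main.v *)
(* The group of monomials is isomorphic to the lattice Z^m with m = 2r + 1, since
   a finitely generated torsion-free abelian group of rank r has a Z-basis with r
   elements. A lattice is totally ordered, so that in a product of two elements of
   its group algebra the two extreme coefficients cannot cancel, and the only
   units are the a *: mon k with a != 0. An automorphism f therefore maps mon v to
   a multiple of a monomial, and multiplicativity turns this into
   f (mon v) = c(v) *: mon (M v) with c a character of the lattice and M an
   integer matrix; the inverse of f shows that M is invertible. *)
Require Import Defs.
From HB Require Import structures.
From mathcomp Require Import all_boot all_order all_algebra.
From mathcomp Require Import finmap.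
From mathcomp Require Import reals complex.

Set Implicit Arguments.
Unset Strict Implicit.
Unset Printing Implicit Defensive.

Import GRing.Theory Num.Theory.

Local Open Scope ring_scope.

Section Bases.
Variable A : zmodType.

Definition zgenerates (n : nat) (s : 'I_n -> A) :=
  forall a, exists c : 'I_n -> int, a = \sum_i s i *~ c i.

Lemma zcomb_mul (m n : nat) (s : 'I_m -> A) (U : 'M[int]_(n, m))
    (c : 'I_n -> int) :
  \sum_i (\sum_k s k *~ U i k) *~ c i = \sum_k s k *~ (\sum_i c i * U i k).
Proof.
under eq_bigr => i _ do rewrite mulrz_suml.
rewrite exchange_big; apply: eq_bigr => k _ /=.
rewrite mulrz_sumr; apply: eq_bigr => i _.
by rewrite -mulrzA mulrC.
Qed.

Lemma zgenerates_unimodular (n : nat) (s : 'I_n -> A) (U : 'M[int]_n) :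
  U \in unitmx -> zgenerates s -> zgenerates (fun i => \sum_k s k *~ U i k).
Proof.
move=> uU gen_s a; have [c ->] := gen_s a.
exists (fun j => \sum_i c i * invmx U i j); rewrite zcomb_mul.
apply: eq_bigr => k _; congr (_ *~ _).
transitivity (((\row_i c i) *m (invmx U *m U)) ord0 k).
  by rewrite mulVmx // mulmx1 mxE.
rewrite mulmxA mxE; apply: eq_bigr => j _.
by rewrite mxE; congr (_ * _); apply: eq_bigr => i _; rewrite mxE.
Qed.

(* Smith normal form of the row of coefficients of a relation: in suitable
   generators it reads [s'_0 *~ d = 0] with [d != 0], so that [s'_0 = 0]. *)
Lemma zgenerates_drop (n : nat) (s : 'I_n.+1 -> A) :
    ztorsion_free A -> zgenerates s -> ~ zfree s ->
  exists s' : 'I_n -> A, zgenerates s'.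
Proof.
move=> tfA gen_s not_free.
have [c [rel_c [i0 ci0]]] :
    exists c : 'I_n.+1 -> int, \sum_i s i *~ c i = 0 /\ exists i, c i <> 0.
  apply: contrapT => no_rel; apply: not_free => c rel_c i.
  by apply: contrapT => ci; apply: no_rel; exists c; split=> //; exists i.
have [L uL [U uU [d _ cE]]] := int_Smith_normal_form (\row_i c i).
set D := (X in L *m X) in cE.
pose s' i := \sum_k s k *~ U i k.
have gen_s' : zgenerates s' by apply: zgenerates_unimodular.
have ccE k : c k = (L *m D) ord0 ord0 * U ord0 k.
  have /rowP/(_ k) := cE; rewrite mxE => ->.
  rewrite mxE big_ord_recl big1 ?addr0 // => i _.
  by rewrite !mxE big_ord1 !mxE /= mulr0n mulr0 mul0r.
have s'0 : s' ord0 = 0.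
  have /tfA[//|d0] : s' ord0 *~ (L *m D) ord0 ord0 = 0.
    rewrite /s' mulrz_suml -[RHS]rel_c; apply: eq_bigr => k _.
    by rewrite -mulrzA ccE mulrC.
  by case: ci0; rewrite ccE d0 mul0r.
exists (fun i => s' (lift ord0 i)) => a; have [e ->] := gen_s' a.
by exists (fun i => e (lift ord0 i)); rewrite big_ord_recl s'0 mul0rz add0r.
Qed.

Lemma zbasis_exists :
  zfin_gen A -> ztorsion_free A -> exists n (b : 'I_n -> A), zbasis b.
Proof.
move=> [n [s gen_s]] tfA; elim: n s gen_s => [|n IH] s gen_s.
  by exists 0, s; split=> // c _ [].
have [free_s|not_free] := pselect (zfree s); first by exists n.+1, s.
by have [s' gen_s'] := zgenerates_drop tfA gen_s not_free; apply: IH gen_s'.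
Qed.

Lemma zfree_le_gen (n m : nat) (b : 'I_n -> A) (f : 'I_m -> A) :
  zgenerates b -> zfree f -> (m <= n)%N.
Proof.
move=> gen_b free_f; rewrite leqNgt; apply/negP => lt_nm.
have [C fE] := choice (fun i => gen_b (f i)).
pose M : 'M[int]_(m, n) := \matrix_(i, j) C i j.
have [L uL [U uU [d _ ME]]] := int_Smith_normal_form M.
set D := (X in L *m X) in ME.
pose k : 'I_m := Ordinal lt_nm.
pose x := row k (invmx L).
have xM : x *m M = 0.
  rewrite /x ME -row_mul mulmxA mulmxA mulVmx // mul1mx row_mul.
  rewrite (_ : row k D = 0) ?mul0mx //; apply/rowP => j; rewrite !mxE /=.
  by rewrite gtn_eqF ?mulr0n.
have x0 : x = 0.
  apply/rowP => i; rewrite [RHS]mxE; apply: (free_f (fun i => x ord0 i)).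
  under eq_bigr => j _ do rewrite fE.
  transitivity (\sum_i (\sum_l b l *~ M i l) *~ x ord0 i).
    by apply: eq_bigr => j _; congr (_ *~ _); apply: eq_bigr => l _; rewrite mxE.
  rewrite zcomb_mul big1 // => l _.
  by have /rowP/(_ l) := xM; rewrite !mxE => ->; rewrite mulr0z.
have /rowP/(_ k) : x *m L = 0 by rewrite x0 mul0mx.
by rewrite /x -row_mul mulVmx // !mxE eqxx.
Qed.

Lemma zbasis_rank (r : nat) :
    zfin_gen A -> ztorsion_free A -> has_zrank A r ->
  exists b : 'I_r -> A, zbasis b.
Proof.
move=> fgA tfA [[f free_f] max_r].
have [n [b [free_b gen_b]]] := zbasis_exists fgA tfA.
have le_nr := max_r _ _ free_b; have le_rn := zfree_le_gen gen_b free_f.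
have <- : n = r by apply/eqP; rewrite eqn_leq le_nr le_rn.
by exists b.
Qed.

End Bases.

Section TopCoefficient.
Variables (F : fieldType) (G : zmodType) (pos : G -> Prop).
Hypotheses (posD : forall k l, pos k -> pos l -> pos (k + l))
  (pos0 : ~ pos 0)
  (posV : forall k, [\/ k = 0, pos k | pos (- k)]).

Lemma seq_pos_max (s : seq G) (k0 : G) : k0 \in s ->
  exists2 k, k \in s & forall l, l \in s -> l = k \/ pos (k - l).
Proof.
elim: s k0 => [|k s IH] // k0 _; case: s IH => [|k1 s] IH.
  by exists k => [|l]; rewrite ?mem_head // inE => /eqP; left.
have [m m_s max_m] := IH k1 (mem_head _ _).
have [/subr0_eq km|km|mk] := posV (k - m).
- exists m; first by rewrite inE m_s orbT.
  by move=> l; rewrite inE => /orP[/eqP ->|/max_m]; [left|].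
- exists k => [|l]; rewrite ?mem_head // inE => /orP[/eqP|/max_m]; first by left.
  by case=> [->|ml]; right=> //; rewrite -(subrKA m); apply: posD.
- exists m; first by rewrite inE m_s orbT.
  move=> l; rewrite inE => /orP[/eqP ->|/max_m //].
  by right; rewrite -opprB.
Qed.

Lemma grpalg_top_coeff (x y : grpalg F G) : x != 0 -> y != 0 ->
  exists k l, [/\ k \in msupp x, l \in msupp y,
    forall k', k' \in msupp x -> k' = k \/ pos (k - k'),
    forall l', l' \in msupp y -> l' = l \/ pos (l - l')
    & mcoeff (k + l) (x * y) != 0].
Proof.
have topx (z : grpalg F G) : z != 0 ->
    exists2 k, k \in msupp z & forall l, l \in msupp z -> l = k \/ pos (k - l).
  have [supp0|[k k_z] _] := fset_0Vmem (msupp z); last exact: seq_pos_max k_z.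
  by rewrite (grpalgE z) supp0 big_seq_fset0 eqxx.
move=> /topx[k k_x max_k] /topx[l l_y max_l]; exists k, l; split=> //.
have -> : x * y = gamul x y by [].
have sumE : mcoeff (k + l) (gamul x y) = mcoeff k x * mcoeff l y.
  rewrite /gamul raddf_sum (big_fsetD1 k) //= raddf_sum (big_fsetD1 l) //=.
  rewrite mcoeffUU !big1_fset ?addr0 //.
    move=> k' /fsetD1P[k'k k'x] _; rewrite raddf_sum big1_fset // => l' l'y _.
    rewrite /= mcoeffU; case: eqP => // sum_eq; exfalso.
    have [/eqP|kk'] := max_k _ k'x; first by rewrite (negbTE k'k).
    have E : k - k' = l' - l.
      by apply/eqP; rewrite subr_eq addrAC eq_sym subr_eq addrC sum_eq.
    have [ll'|ll'] := max_l _ l'y.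
      by apply: pos0; rewrite ll' subrr in E; rewrite -E.
    by apply: pos0; rewrite -(subrr (k - k')) {2}E opprB; apply: posD.
  move=> l' /fsetD1P[l'l _] _; rewrite mcoeffU; case: eqP => // /addrI /eqP.
  by rewrite (negbTE l'l).
by rewrite sumE mulf_neq0 // mcoeff_neq0.
Qed.

End TopCoefficient.

(* If [x * y = 1], the sums of the two largest and of the two smallest monomials
   of [x] and [y] both occur in [x * y], hence both are [0]. *)
Lemma grpalg_unit (F : fieldType) (G : zmodType) (pos : G -> Prop)
    (posD : forall k l, pos k -> pos l -> pos (k + l)) (pos0 : ~ pos 0)
    (posV : forall k, [\/ k = 0, pos k | pos (- k)]) (x y : grpalg F G) :
  x * y = 1 -> exists a k, a != 0 /\ x = a *: mon F k.
Proof.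
move=> xy1.
have x0 : x != 0.
  by apply/eqP => x0; move/eqP: xy1; rewrite x0 mul0r eq_sym oner_eq0.
have y0 : y != 0.
  by apply/eqP => y0; move/eqP: xy1; rewrite y0 mulr0 eq_sym oner_eq0.
have coeff1 k : mcoeff k (1 : grpalg F G) != 0 -> k = 0.
  by rewrite -mon0 mcoeffU; case: (0 =P k) => // _; rewrite eqxx.
have negD k l : pos (- k) -> pos (- l) -> pos (- (k + l)).
  by rewrite opprD; apply: posD.
have neg0 : ~ pos (- 0) by rewrite oppr0.
have negV k : [\/ k = 0, pos (- k) | pos (- - k)].
  by rewrite opprK; case: (posV k); [constructor 1|constructor 3|constructor 2].
have [k [l [k_x l_y max_k max_l]]] := grpalg_top_coeff posD pos0 posV x0 y0.
rewrite xy1 => /coeff1/eqP; rewrite addr_eq0 => /eqP kE.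
have [k2 [l2 [k2_x l2_y min_k min_l]]] := grpalg_top_coeff negD neg0 negV x0 y0.
rewrite xy1 => /coeff1/eqP; rewrite addr_eq0 => /eqP k2E.
have kk2 : k2 = k.
  have [//|kk2] := max_k _ k2_x; have [l2l|ll2] := max_l _ l2_y.
    by rewrite k2E l2l kE.
  case: pos0; rewrite -(subrr (l - l2)); apply: posD => //.
  by move: kk2; rewrite kE k2E opprK opprB addrC.
exists (mcoeff k x), k; rewrite mcoeff_neq0 k_x; split=> //.
rewrite [LHS]grpalgE (_ : msupp x = [fset k]%fset) ?big_seq_fset1 //.
apply/fsetP => k'; rewrite inE; apply/idP/eqP => [k'_x|-> //].
have [//|pos_kk'] := max_k _ k'_x.
have [->|] := min_k _ k'_x; rewrite kk2 // => neg_kk'.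
by case: pos0; rewrite -(subrr (k - k')); apply: posD.
Qed.

Section LexOrder.
Variable m : nat.

Definition lexpos (v : 'cV[int]_m) :=
  exists i, 0 < v i ord0 /\ forall j : 'I_m, (j < i)%N -> v j ord0 = 0.

Lemma lexposD u v : lexpos u -> lexpos v -> lexpos (u + v).
Proof.
move=> [i [ui u0]] [j [vj v0]]; have [lt_ij|lt_ji|eq_ij] := ltngtP i j.
- exists i; rewrite mxE (v0 i) // addr0; split=> // k lt_ki.
  by rewrite mxE u0 // v0 ?addr0 // (ltn_trans lt_ki).
- exists j; rewrite mxE (u0 j) // add0r; split=> // k lt_kj.
  by rewrite mxE v0 // u0 ?addr0 // (ltn_trans lt_kj).
- have {}eq_ij : i = j by apply: val_inj.
  exists i; split=> [|k lt_ki]; first by rewrite mxE addr_gt0 // eq_ij.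
  by rewrite mxE u0 // v0 ?addr0 // -eq_ij.
Qed.

Lemma lexpos0 : ~ lexpos 0.
Proof. by move=> [i []]; rewrite mxE Order.POrderTheory.ltxx. Qed.

Lemma lexposV v : [\/ v = 0, lexpos v | lexpos (- v)].
Proof.
have [/forallP v0|] := boolP [forall i, v i ord0 == 0].
  by constructor 1; apply/matrixP => i j; rewrite [j]ord1 mxE; apply/eqP/v0.
rewrite negb_forall => /existsP[i0 vi0].
case: (@arg_minnP _ i0 (fun i => v i ord0 != 0) (@nat_of_ord m) vi0) => i vi min_i.
have below (j : 'I_m) : (j < i)%N -> v j ord0 = 0.
  by apply: contraTeq => /min_i; rewrite leqNgt.
have [vi_gt|vi_lt|/eqP] := Order.TotalTheory.ltgtP 0 (v i ord0).
- by constructor 2; exists i.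
- constructor 3; exists i; rewrite mxE oppr_gt0; split=> // j /below.
  by rewrite mxE => ->; rewrite oppr0.
- by rewrite eq_sym (negbTE vi).
Qed.

End LexOrder.

Section TorusCharacters.
Variables (F : fieldType) (m : nat).
Implicit Types (c d : torus F m) (u v : 'cV[int]_m).

Definition tchar c v : F := \prod_i uval (c i) ^ v i ord0.

Let uval_neq0 (a : unit_group F) : uval a != 0.
Proof. by rewrite -unitfE uvalP. Qed.

Lemma tchar_neq0 c v : tchar c v != 0.
Proof. by apply/prodf_neq0 => i _; apply: expfz_neq0. Qed.

Lemma tchar0 c : tchar c 0 = 1.
Proof. by rewrite /tchar big1 // => i _; rewrite mxE expr0z. Qed.

Lemma tcharD c u v : tchar c (u + v) = tchar c u * tchar c v.
Proof.
by rewrite -big_split; apply: eq_bigr => i _; rewrite mxE expfzDr.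
Qed.

Lemma tchar_1 v : tchar 1%g v = 1.
Proof. by rewrite /tchar big1 // => i _; rewrite ffunE exp1rz. Qed.

Lemma tcharM c d v : tchar (c * d)%g v = tchar c v * tchar d v.
Proof.
rewrite -big_split; apply: eq_bigr => i _.
by rewrite ffunE uvalM expfzMl.
Qed.

Lemma tchar_delta c i : tchar c (delta_mx i ord0) = uval (c i).
Proof.
rewrite /tchar (bigD1 i) //= big1 => [|j /negbTE ji].
  by rewrite mxE !eqxx mulr1.
by rewrite mxE ji.
Qed.

Lemma tchar_inj c d : tchar c =1 tchar d -> c = d.
Proof.
by move=> cd; apply/ffunP => i; apply: val_inj; rewrite /= -!tchar_delta cd.
Qed.

Lemma tchar_act (M : GLZ m) c v :
  tchar (torus_act M c) v = tchar c (glmx M^-1%g *m v).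
Proof.
rewrite /tchar; under eq_bigr => i _ do rewrite torus_actE.
transitivity (\prod_i \prod_j uval (c j) ^ (glmx M^-1%g j i * v i ord0)).
  apply: eq_bigr => i _.
  rewrite (big_morph (fun x => x ^ v i ord0) (fun x y => expfzMl x y _)
    (exp1rz _ _)).
  by apply: eq_bigr => j _; rewrite exprz_exp.
rewrite exchange_big; apply: eq_bigr => j _ /=; rewrite mxE.
by rewrite (big_morph (exprz _) (fun x y => expfzDr x y (uval_neq0 _)) (expr0z _)).
Qed.

End TorusCharacters.

Section AlgAutMorphism.
Variables (F : fieldType) (B : algType F) (f : algAut B).

HB.instance Definition _ := GRing.isLinear.Build F B B *:%R f (aut_linear f).
HB.instance Definition _ := GRing.isMonoidMorphism.Build B B f (aut_monoid f).

Lemma algAutZ (a : F) (x : B) : f (a *: x) = a *: f x.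
Proof. exact: linearZ_LR. Qed.

End AlgAutMorphism.

Lemma lattice_mul_ext (m : nat) (S : comNzRingType) (f g : 'cV[int]_m -> S) :
    f 0 = 1 -> g 0 = 1 ->
    (forall u v, f (u + v) = f u * f v) -> (forall u v, g (u + v) = g u * g v) ->
    (forall i, f (delta_mx i ord0) = g (delta_mx i ord0)) ->
  f =1 g.
Proof.
move=> f0 g0 fD gD fg v.
have fgD u w : f u = g u -> f w = g w -> f (u + w) = g (u + w).
  by move=> fgu fgw; rewrite fD gD fgu fgw.
have fgN u : f u = g u -> f (- u) = g (- u).
  move=> fgu; rewrite -[LHS]mulr1 -g0 -(subrr u) gD mulrA -fgu -fD addNr f0.
  by rewrite mul1r.
have fgX u n : f u = g u -> f (u *+ n) = g (u *+ n).
  move=> fgu; elim: n => [|n IH]; first by rewrite !mulr0n f0 g0.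
  by rewrite mulrS; apply: fgD.
rewrite [v]matrix_sum_delta; elim/big_ind: _ => [|//|i _]; first by rewrite f0 g0.
rewrite big_ord1 -[v i ord0]intz scaler_int.
by case: (v i ord0) => n; [|apply: (fgN)]; apply: fgX; apply: fg.
Qed.

Section LatticeAlgebra.
Variables (F : fieldType) (G : zmodType) (m : nat).
Variables (lat : 'cV[int]_m -> G) (coord : G -> 'cV[int]_m).
Hypotheses (latD : {morph lat : u v / u + v}).
Hypotheses (latK : cancel lat coord) (coordK : cancel coord lat).
Local Notation B := (grpalg F G).
Local Notation sdGL := (semidirect (torus_gaction F m)).

Let lat0 : lat 0 = 0.
Proof. by apply: (addrI (lat 0)); rewrite -latD !addr0. Qed.

Let latN v : lat (- v) = - lat v.
Proof. by apply: (addrI (lat v)); rewrite -latD !subrr lat0. Qed.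

Let coordD : {morph coord : k l / k + l}.
Proof. by move=> k l; apply: (can_inj latK); rewrite latD !coordK. Qed.

Let coord0 : coord 0 = 0.
Proof. by apply: (can_inj latK); rewrite lat0 coordK. Qed.

Let coordN k : coord (- k) = - coord k.
Proof. by apply: (can_inj latK); rewrite latN !coordK. Qed.

Lemma lattice_unit (x y : B) :
  x * y = 1 -> exists a v, a != 0 /\ x = a *: mon F (lat v).
Proof.
move=> /(grpalg_unit (pos := fun k => lexpos (coord k))).
case=> [k l|||a [k [a0 ->]]].
- by rewrite coordD; apply: lexposD.
- by rewrite coord0; apply: lexpos0.
- move=> k; rewrite coordN; case: (lexposV (coord k)) => [k0||].
  + by constructor 1; rewrite -[k]coordK k0 lat0.
  + by constructor 2.
  + by constructor 3.
- by exists a, (coord k); rewrite coordK.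
Qed.

Lemma scale_mon_inj (a b : F) (k l : G) :
  a != 0 -> a *: mon F k = b *: mon F l -> a = b /\ k = l.
Proof.
move=> a0 E.
have /(congr1 (mcoeff k)) := E; rewrite !mcoeffZ !mcoeffU eqxx mulr1.
have [<-|_] := l =P k; first by rewrite mulr1.
by rewrite mulr0 => a_eq0; rewrite a_eq0 eqxx in a0.
Qed.

Definition semi_mon (x : sdGL) (k : G) : B :=
  tchar (sd_norm x) (glmx (sd_compl x) *m coord k)
    *: mon F (lat (glmx (sd_compl x) *m coord k)).

Let semi_mon0 x : semi_mon x 0 = 1.
Proof. by rewrite /semi_mon coord0 mulmx0 tchar0 lat0 scale1r. Qed.

Let semi_monD x k l : semi_mon x (k + l) = semi_mon x k * semi_mon x l.
Proof.
rewrite /semi_mon coordD mulmxDr tcharD latD monM.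
by rewrite -scalerAl -scalerAr scalerA.
Qed.

Definition semi_lift (x : sdGL) : {lrmorphism B -> B} :=
  projT1 (cid (grpalg_lift (semi_mon0 x) (semi_monD x))).

Let semi_lift_mon x k : semi_lift x (mon F k) = semi_mon x k.
Proof. exact: (projT2 (cid (grpalg_lift (semi_mon0 x) (semi_monD x)))). Qed.

Let semi_liftZ x a z : semi_lift x (a *: z) = a *: semi_lift x z.
Proof. exact: linearZ_LR. Qed.

Let semi_liftM x y : semi_lift (x * y)%g =1 semi_lift x \o semi_lift y.
Proof.
apply: grpalg_ext => k /=; rewrite !semi_lift_mon {2}/semi_mon semi_liftZ.
rewrite semi_lift_mon /semi_mon latK scalerA /= mulmxA tcharM tchar_act.
by rewrite -mulmxA mulKmx ?glmxP // mulrC mulmxA.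
Qed.

Let semi_lift1 : semi_lift 1%g =1 id.
Proof.
apply: (@grpalg_ext _ _ _ (semi_lift 1%g) idfun) => k.
apply: etrans (semi_lift_mon _ _) _.
by rewrite /semi_mon /= mul1mx tchar_1 scale1r coordK.
Qed.

Definition semi_aut (x : sdGL) : algAut B.
Proof.
exists (semi_lift x) (semi_lift x^-1%g).
- exact: linearP.
- by split; [apply: rmorph1 | apply: rmorphM].
- by move=> z; rewrite -[LHS]semi_liftM mulVg semi_lift1.
- by move=> z; rewrite -[LHS]semi_liftM mulgV semi_lift1.
Defined.

Let semi_autM : {morph semi_aut : x y / (x * y)%g}.
Proof. by move=> x y; apply: algAut_eq => z; apply: semi_liftM. Qed.

HB.instance Definition _ :=
  isMultiplicative.Build sdGL (algAut B) semi_aut semi_autM.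

Lemma semi_aut_mon c M v :
  semi_aut (SemiPair (torus_gaction F m) c M) (mon F (lat v)) =
    tchar c (glmx M *m v) *: mon F (lat (glmx M *m v)).
Proof. by rewrite /= semi_lift_mon /semi_mon latK. Qed.

Lemma semi_aut_inj : injective semi_aut.
Proof.
move=> [c M] [d N] E.
have Ev v : tchar c (glmx M *m v) = tchar d (glmx N *m v) /\
            glmx M *m v = glmx N *m v.
  have /scale_mon_inj[|-> /(can_inj latK) //] :
      tchar c (glmx M *m v) *: mon F (lat (glmx M *m v)) =
      tchar d (glmx N *m v) *: mon F (lat (glmx N *m v)).
    by rewrite -!semi_aut_mon E.
  exact: tchar_neq0.
have MN : M = N.
  apply: val_inj => /=; apply/matrixP => i j.
  have [_ /matrixP/(_ i ord0)] := Ev (delta_mx j ord0).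
  by rewrite -!colE !mxE.
subst N; congr SemiPair; apply: tchar_inj => v.
by have [] := Ev (invmx (glmx M) *m v); rewrite mulKVmx ?glmxP.
Qed.

Lemma algAut_lattice_mon (f : algAut B) :
  exists c M, forall v, f (mon F (lat v)) = tchar c v *: mon F (lat (M *m v)).
Proof.
have image_mon i : exists au : unit_group F * 'cV[int]_m,
    f (mon F (lat (delta_mx i ord0))) = uval au.1 *: mon F (lat au.2).
  have [|a [v [a0 fE]]] := @lattice_unit (f (mon F (lat (delta_mx i ord0))))
      (f (mon F (- lat (delta_mx i ord0)))).
    by rewrite -rmorphM -monM subrr mon0 rmorph1.
  by rewrite -unitfE in a0; exists (UnitGroup a0, v).
have [au auE] := choice image_mon.
pose c : torus F m := [ffun i => (au i).1].
pose M : 'M[int]_m := \matrix_(i, j) (au j).2 i ord0.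
exists c, M; apply: lattice_mul_ext.
- by rewrite lat0 mon0 rmorph1.
- by rewrite tchar0 mulmx0 lat0 scale1r.
- by move=> u v; rewrite latD monM rmorphM.
- move=> u v; rewrite tcharD mulmxDr latD monM.
  by rewrite -scalerAl -scalerAr scalerA.
- move=> i; rewrite auE tchar_delta ffunE -colE; congr (_ *: mon F (lat _)).
  by apply/matrixP => k j; rewrite [j]ord1 !mxE.
Qed.

Lemma semi_aut_surj (f : algAut B) : exists x, semi_aut x = f.
Proof.
have [c [M fE]] := algAut_lattice_mon f.
have [d [N gE]] := algAut_lattice_mon (f^-1)%g.
have MN : M *m N = 1%:M.
  have MNv (v : 'cV_m) : M *m N *m v = v.
    have /esym : f ((f^-1)%g (mon F (lat v))) = mon F (lat v).
      by rewrite -aut_funM mulgV.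
    rewrite gE algAutZ fE scalerA mulmxA -[LHS]scale1r.
    by move=> /scale_mon_inj[|_ /(can_inj latK) <-]; rewrite ?oner_neq0.
  apply/matrixP => i j; have /matrixP/(_ i ord0) := MNv (delta_mx j ord0).
  by rewrite -colE !mxE andbT.
have [uM _] := mulmx1_unit MN.
pose x : sdGL := SemiPair _ 1%g (MkGLZ uM); pose y : sdGL := SemiPair _ c 1%g.
have xyE k : semi_aut (x * y)%g (mon F k) = f (mon F k).
  rewrite semi_autM aut_funM -[k]coordK !semi_aut_mon mul1mx algAutZ.
  by rewrite semi_aut_mon tchar_1 scale1r fE.
by exists (x * y)%g; apply: algAut_eq; apply: grpalg_ext xyE.
Qed.

Lemma semi_aut_bij : bijective semi_aut.
Proof.
have [g gK] := choice semi_aut_surj.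
by exists g => // x; apply: semi_aut_inj; rewrite gK.
Qed.

End LatticeAlgebra.

Section LatticeMonomials.
Variables (R : realType) (A : zmodType) (p : A) (t : R[i]).
Variables (r : nat) (b : 'I_r -> A).
Local Notation lat := (lattice_mon p t b).

Lemma lattice_monD : {morph lat : u v / u + v}.
Proof.
move=> u v; rewrite /lattice_mon mxE.
by congr (_, (_, _)); rewrite -big_split; apply: eq_bigr => k _;
  rewrite mxE mulrzDr.
Qed.

Lemma lattice_mon_coord : zbasis b ->
  exists coord, cancel lat coord /\ cancel coord lat.
Proof.
move=> [free_b gen_b]; have [c cE] := choice gen_b.
have c_comb (e : 'I_r -> int) : c (\sum_k b k *~ e k) =1 e.
  move=> k; apply/eqP; rewrite -subr_eq0; apply/eqP.
  apply: (free_b (fun j => c (\sum_k b k *~ e k) j - e j)).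
  under eq_bigr => j _ do rewrite mulrzBr.
  by rewrite sumrB -cE subrr.
pose coord (k : monomials p t) : 'cV[int]_(1 + (r + r)) :=
  col_mx (const_mx k.1) (col_mx (\col_i c k.2.1 i) (\col_i c k.2.2 i)).
exists coord; split=> [v|[z [a1 a2]]].
  apply/colP => i; rewrite /coord /=.
  case: (split_ordP i) => [j ->|i' ->]; first by rewrite col_mxEu mxE [j]ord1.
  rewrite col_mxEd.
  by case: (split_ordP i') => j ->; rewrite ?col_mxEu ?col_mxEd mxE c_comb.
rewrite /lattice_mon /coord /= col_mxEu mxE; congr (_, (_, _)).
  by rewrite [RHS]cE; apply: eq_bigr => k _; rewrite col_mxEd col_mxEu mxE.
by rewrite [RHS]cE; apply: eq_bigr => k _; rewrite !col_mxEd mxE.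
Qed.

End LatticeMonomials.

Unset Implicit Arguments.

Theorem theorem4p3 (F : fieldType) (charF0 : [pchar F] =i pred0)
    (R : realType) (A : zmodType) (r : nat) (p : A) (t : R[i])
    (finA : zfin_gen A) (tfA : ztorsion_free A) (rkA : has_zrank A r)
    (r_ge2 : (2 <= r)%N) (p_neq0 : p != 0) :
  exists b : 'I_r -> A, zbasis b /\
  exists Phi : {multiplicative
      semidirect (torus_gaction F (1 + (r + r))) -> algAut (Ralg F p t)},
    [/\ bijective Phi,
        forall (c : torus F (1 + (r + r))) (i : 'I_(1 + (r + r))),
          Phi (SemiPair (torus_gaction F _) c 1%g) (Rgen F p t b i) =
            uval (c i) *: Rgen F p t b i
      & forall (M : GLZ (1 + (r + r))) (v : 'cV[int]_(1 + (r + r))),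
          Phi (SemiPair (torus_gaction F _) 1%g M) (Rmon F (lattice_mon p t b v)) =
            Rmon F (lattice_mon p t b (glmx M *m v)) ].
Proof.
have [b basis_b] := zbasis_rank finA tfA rkA; exists b; split=> //.
have [coord [latK coordK]] := lattice_mon_coord p t basis_b.
have latD := lattice_monD p t b.
exists (semi_aut (F := F) latD latK coordK); split.
- exact: semi_aut_bij.
- move=> c i; rewrite -Rmon_lattice_delta.
  by rewrite [LHS]semi_aut_mon mul1mx tchar_delta.
- by move=> M v; rewrite [LHS]semi_aut_mon tchar_1 scale1r.
Qed.
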